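(* Every finitely generated metabelian Lie $U$-algebra $A$ over a field $k$ is isomorphic to a subalgebra of the matrix metabelian Lie algebra $M^0_{I,\Lambda}$ for some sets $I$ and $\Lambda$. Conversely, for any sets $I,\Lambda$, every subalgebra of $M^0_{I,\Lambda}$ is a metabelian Lie $U$-algebra.
   Context: All algebras are over a fixed field $k$. A Lie algebra $A$ is metabelian if $(a\circ b)\circ(c\circ d)=0$ for all $a,b,c,d\in A$. $A^2$ denotes the ideal spanned by all products $a\circ b$. The Fitting radical $\mathrm{Fit}(A)$ is the ideal generated by all elements lying in nilpotent ideals of $A$. If $J$ is an abelian ideal of a metabelian Lie algebra $A$ with $A^2\subseteq J$, choose a family $\{a_\alpha:\alpha\in\Lambda\}$ of elements of $A$ whose images form a basis of $A/J$ and let $R=k[x_\alpha:\alpha\in\Lambda]$ be the commutative polynomial ring; $J$ becomes an $R$-module via $b\cdot x_\alpha=b\circ a_\alpha$ ($b\in J$), extended multiplicatively and $k$-linearly (well defined; another choice of family changes the variables by an invertible linear substitution). A metabelian Lie algebra $A$ is a (metabelian Lie) $U$-algebra if $\mathrm{Fit}(A)$ is abelian and $\mathrm{Fit}(A)$, with this $R$-module structure (taking $J=\mathrm{Fit}(A)$), is torsion-free. Matrix algebras: for sets $I,\Lambda$ let $R=k[x_\alpha:\alpha\in\Lambda]$ and $T$ the free $R$-module with basis $\{u_i:i\in I\}$; $M_{I,\Lambda}$ is the set of pairs $(f,u)$, $f\in R$, $u\in T$ (matrices $\begin{pmatrix} f&u\\0&0\end{pmatrix}$), with componentwise addition and scalar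 multiplication and product $(f,u)\circ(g,v)=(0,\,u g-v f)$; it is a metabelian Lie $k$-algebra. $M^0_{I,\Lambda}$ is the subalgebra of all $(f,u)$ with $f$ a $k$-linear combination of the variables $x_\alpha$ (possibly $f=0$). $\Lambda=\emptyset$ is allowed (then $R=k$). *)

(* Defs.v *)
From HB Require Import structures.
From mathcomp Require Import all_boot all_order all_algebra.
From mathcomp Require Import finmap.
From mathcomp Require Import monalg.

Set Implicit Arguments.
Unset Strict Implicit.
Unset Printing Implicit Defensive.

Import GRing.Theory.
Local Open Scope ring_scope.


(* Lie algebras over a field k, given as a bracket on a k-vector space *)
(* V.  Subsets of V are predicates V -> Prop; a (sub)algebra is a      *)
(* included S closed under the vector space operations and the bracket; *)
(* a Lie algebra "in its own right" is the case S = setAll.            *)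
Section Lie.
Variables (k : fieldType) (V : lmodType k) (br : V -> V -> V).

Definition is_lie_bracket : Prop :=
  [/\ (forall (c : k) (x y z : V), br (c *: x + y) z = c *: br x z + br y z),
      (forall (c : k) (x y z : V), br z (c *: x + y) = c *: br z x + br z y),
      (forall x : V, br x x = 0) &
      (forall x y z : V, br x (br y z) + br y (br z x) + br z (br x y) = 0)].

Definition setAll : V -> Prop := fun _ => True.

Definition included (P Q : V -> Prop) : Prop := forall x, P x -> Q x.

Definition is_subspace (S : V -> Prop) : Prop :=
  S 0 /\ forall (c : k) (x y : V), S x -> S y -> S (c *: x + y).

Definition is_subalgebra (S : V -> Prop) : Prop :=
  is_subspace S /\ forall x y, S x -> S y -> S (br x y).

Definition is_ideal (S J : V -> Prop) : Prop :=
  [/\ included J S, is_subspace J &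
      forall x y, S x -> J y -> J (br x y) /\ J (br y x)].

Definition metabelian (S : V -> Prop) : Prop :=
  forall a b c d, S a -> S b -> S c -> S d -> br (br a b) (br c d) = 0.

Definition abelian (J : V -> Prop) : Prop :=
  forall x y, J x -> J y -> br x y = 0.

(* J is nilpotent (as a Lie algebra): for some n, all left-normed
   products (..((x o y1) o y2) .. o yn) of elements of J vanish,
   i.e. J^(n+1) = 0. *)
Definition nilpotent (J : V -> Prop) : Prop :=
  exists n : nat, forall (x : V) (s : seq V),
    size s = n -> J x -> (forall y, y \in s -> J y) -> foldl br x s = 0.

Definition Fit (S : V -> Prop) : V -> Prop := fun x =>
  forall K, is_ideal S K ->
    (forall J, is_ideal S J -> nilpotent J -> included J K) -> K x.

Definition fin_generated (S : V -> Prop) : Prop :=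
  exists s : seq V, (forall x, x \in s -> S x) /\
    forall T, is_subalgebra T -> (forall x, x \in s -> T x) -> included S T.

Definition lin_comb (L : choiceType) (a : L -> V) (c : {malg k[L]}) : V :=
  \sum_(l <- msupp c) c@_l *: a l.

Definition basis_mod (S J : V -> Prop) (L : choiceType) (a : L -> V) : Prop :=
  [/\ forall l, S (a l),
      (forall c : {malg k[L]}, J (lin_comb a c) -> c = 0) &
      (forall x, S x -> exists c : {malg k[L]}, J (x - lin_comb a c))].

(* R = k[x_l : l in L]: commutative polynomial ring in variables
   indexed by L; monomials are {cmonom L}. *)
Definition polyR (L : choiceType) := {malg k[{cmonom L}]}.

(* action of a monomial m = prod_l x_l^(m l) on b: b . x_l = b o a_l *)
Definition mon_act (L : choiceType) (a : L -> V) (m : {cmonom L}) (b : V) : V :=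
  foldr (fun l y => iter (m l) (fun z => br z (a l)) y) b (finsupp m).

Definition pol_act (L : choiceType) (a : L -> V) (b : V) (f : polyR L) : V :=
  \sum_(m <- msupp f) f@_m *: mon_act a m b.

Definition torsion_free (J : V -> Prop) (L : choiceType) (a : L -> V) : Prop :=
  forall (b : V) (f : polyR L), J b -> f != 0 -> pol_act a b f = 0 -> b = 0.

(* metabelian Lie U-algebra (the R-module structure on Fit(S) being
   defined from any family whose images form a basis of S/Fit(S)) *)
Definition U_algebra (S : V -> Prop) : Prop :=
  [/\ metabelian S, abelian (Fit S) &
      forall (L : choiceType) (a : L -> V),
        basis_mod S (Fit S) a -> torsion_free (Fit S) a].

End Lie.

Definition lie_hom (k : fieldType) (A B : lmodType k)
    (brA : A -> A -> A) (brB : B -> B -> B) (phi : A -> B) : Prop :=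
  (forall (c : k) x y, phi (c *: x + y) = c *: phi x + phi y) /\
  (forall x y, phi (brA x y) = brB (phi x) (phi y)).

(* The matrix algebras M_{I,L} and M^0_{I,L}.                          *)
(* T = free R-module with basis (u_i)_{i in I}: finitely supported     *)
(* functions I -> R, i.e. {malg R[I]}, viewed as a k-vector space via  *)
(* k -> R.                                                             *)
Section Matrix.
Variables (k : fieldType) (I L : choiceType).

Local Notation R := (polyR k L).

Definition freeT := {malg R[I]}.

Definition freeT_scale (c : k) (u : freeT) : freeT := (c%:A : R) *: u.

Fact freeT_scaleA c1 c2 u :
  freeT_scale c1 (freeT_scale c2 u) = freeT_scale (c1 * c2) u.
Proof.
apply/malgP => i.
refine (eq_trans (@mcoeffZ I R (c1%:A) (freeT_scale c2 u) i) _).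
refine (eq_trans _ (esym (@mcoeffZ I R ((c1 * c2)%:A) u i))).
refine (eq_trans (f_equal (fun z => c1%:A * z) (@mcoeffZ I R (c2%:A) u i)) _).
refine (eq_trans (mulrA _ _ _) _).
refine (f_equal (fun z => z * u@_i) _).
refine (eq_trans (mulr_algl _ _) _).
exact: scalerA.
Qed.

Fact freeT_scale1 u : freeT_scale 1 u = u.
Proof.
refine (eq_trans (f_equal (fun z => z *: u) (scale1r (1 : R))) _).
exact: scale1r.
Qed.

Fact freeT_scaleDr c u v :
  freeT_scale c (u + v) = freeT_scale c u + freeT_scale c v.
Proof. exact: scalerDr. Qed.

Fact freeT_scaleDl u c1 c2 :
  freeT_scale (c1 + c2) u = freeT_scale c1 u + freeT_scale c2 u.
Proof.
refine (eq_trans (f_equal (fun z => z *: u) (scalerDl (1 : R) c1 c2)) _).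
exact: scalerDl.
Qed.

Definition freeTk := freeT.
HB.instance Definition _ := GRing.Zmodule.on freeTk.
HB.instance Definition _ := GRing.Zmodule_isLmodule.Build k freeTk
  freeT_scaleA freeT_scale1 freeT_scaleDr freeT_scaleDl.

(* M_{I,L}: pairs (f, u), matrices [[f, u], [0, 0]] *)
Definition Mmat := (R * freeTk)%type.

Definition Mbr (x y : Mmat) : Mmat :=
  (0, ((y.1 *: (x.2 : freeT)) - (x.1 *: (y.2 : freeT)) : freeT) : freeTk).

Definition var (l : L) : R := << ucm l >>.

Definition M0 : Mmat -> Prop := fun x =>
  exists c : {malg k[L]}, x.1 = \sum_(l <- msupp c) c@_l *: var l.

End Matrix.

(* Main.v *)
Require Import Defs.
From HB Require Import structures.
From mathcomp Require Import all_boot all_order all_algebra.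
From mathcomp Require Import finmap.
From mathcomp Require Import monalg.
From Stdlib Require Import Classical IndefiniteDescription.

Set Implicit Arguments.
Unset Strict Implicit.
Unset Printing Implicit Defensive.

Import GRing.Theory.
Local Open Scope fset_scope.
Local Open Scope ring_scope.

(** Write J = Fit(A).  If A is a finitely generated U-algebra, A/J has a finite
    basis (a_i), and J is a finitely generated torsion-free module over
    R = k[x_i]: it is generated by the brackets [a_i, a_j] and the J-components
    of the generators of A.  Choosing a maximal R-independent family v in J and
    a common denominator d with J d inside the free module spanned by v, the
    coordinates of b d on v give an injective R-linear map rho : J -> R^m.  For
    J <> A, the map z |-> (linear form of z mod J, rho [z, a_0]) is the
    embedding: it is a morphism by the Jacobi identity
    [[z, w], a_0] = [[z, a_0], w] - [[w, a_0], z], and if z is in its kernel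
    then z lies in J and z x_0 = 0, so z = 0.

    Conversely, a nonabelian subalgebra S of M^0 contains some (0, t) with
    t <> 0, and (0, t f^n) <> 0 for f <> 0, so Fit(S) consists of the (0, u) in
    S.  A basis of S modulo Fit(S) has linearly independent linear forms as
    first components; these are algebraically independent, which is
    torsion-freeness. *)

(** * Polynomial rings over a field are integral domains *)

Section PolyDomain.
Variables (k : fieldType) (L : choiceType).
Implicit Types (m : {cmonom L}) (N : nat) (s : seq L).

(* Kronecker substitution: the i-th variable of [s] goes to 'X^(N ^ i), which
   separates the monomials in these variables with exponents below N. *)
Definition kron_weight N s m : nat := foldr (fun l w => m l + N * w)%N 0%N s.

Lemma kron_weight1 N s : kron_weight N s (mone : {cmonom L}) = 0%N.
Proof. by elim: s => //= l s ->; rewrite cm1 muln0. Qed.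

Lemma kron_weightM N s m1 m2 :
  kron_weight N s (mmul m1 m2) = (kron_weight N s m1 + kron_weight N s m2)%N.
Proof. by elim: s => //= l s ->; rewrite cmM mulnDr addnACA. Qed.

(** The exponents along [s] are the base-[N] digits of the weight: reduction modulo [N] reads the
    first one, and the induction handles the quotient. *)
Lemma kron_weight_inj N s m1 m2 :
  (forall l, m1 l < N)%N -> (forall l, m2 l < N)%N ->
  kron_weight N s m1 = kron_weight N s m2 -> {in s, m1 =1 m2}.
Proof.
move=> lt1 lt2; elim: s => //= l s IH E.
have El : m1 l = m2 l.
  move/(congr1 (modn^~ N)): E; rewrite ![(N * _)%N]mulnC.
  by rewrite ![(_ + _ * N)%N]addnC /= !modnMDl !modn_small.
move: E; rewrite El => /addnI /eqP; rewrite eqn_pmul2l ?(leq_trans _ (lt1 l)) //.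
by move=> /eqP/IH Es i; rewrite inE => /orP[/eqP->|/Es].
Qed.

Definition kron N s m : {poly k} := 'X^(kron_weight N s m).

Fact kron_mmorphism N s : mmorphism (kron N s).
Proof.
by split=> [m1 m2|]; rewrite /kron ?kron_weightM ?exprD // kron_weight1.
Qed.
HB.instance Definition _ N s :=
  isMultiplicative.Build _ _ (kron N s) (kron_mmorphism N s).

Lemma cmonom_le_mdeg m l : (m l <= mdeg m)%N.
Proof.
case: mdomP => // ml; rewrite mdegE (big_fsetD1 l) //=; exact: leq_addr.
Qed.

(** The coefficient of the image at the weight of a monomial [m] of [f] is [f@_m], because no other
    monomial of the support has that weight. *)
Lemma kron_neq0 N s (f : polyR k L) :
  (forall m, m \in msupp f -> (mdeg m < N)%N /\ {subset finsupp m <= s}) ->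
  f != 0 -> mmap (@polyC k) (kron N s) f != 0.
Proof.
move=> supp_f f0.
have [m mf] : exists m, m \in msupp f.
  by apply/fset0Pn; rewrite msupp_eq0.
apply/eqP => /(congr1 (fun p : {poly k} => p`_(kron_weight N s m))).
rewrite coef0 mmapE coef_sum (big_fsetD1 m) //= big1_seq => [|m' /=].
  rewrite coefCM coefXn eqxx mulr1 addr0 => /eqP.
  by rewrite mcoeff_eq0 mf.
rewrite in_fsetD1 => /andP[ne m'f]; rewrite coefCM coefXn.
case: eqP => [E|]; last by rewrite mulr0.
have [lt sub] := supp_f _ mf; have [lt' sub'] := supp_f _ m'f.
case/negP: ne; apply/cmP => i.
have [si|nsi] := boolP (i \in s).
  apply: (@kron_weight_inj N s) => // l;
  exact: leq_ltn_trans (cmonom_le_mdeg _ l) _.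
(* Outside [s] both exponents vanish, since [s] contains both supports. *)
transitivity 0%N; [apply/eqP|apply/esym/eqP]; rewrite cmE_eq0.
- exact: contra (sub' i) nsi.
- exact: contra (sub i) nsi.
Qed.

Lemma polyR_domain (f g : polyR k L) : f * g = 0 -> f = 0 \/ g = 0.
Proof.
move=> fg0; apply: NNPP => /not_or_and[/eqP f0 /eqP g0].
pose E := msupp f `|` msupp g.
(* One substitution serves [f] and [g]: [N] exceeds every total degree, hence every exponent,
   occurring in either. *)
pose N := (\max_(m <- E) mdeg m).+1.
pose s := flatten [seq (finsupp m : seq L) | m <- E].
have EP m : m \in E -> (mdeg m < N)%N /\ {subset finsupp m <= s}.
  move=> mE; split; first by rewrite ltnS (big_fsetD1 m) //= leq_maxl.
  move=> l lm; apply/flattenP; exists (enum_fset (finsupp m)) => //.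
  by apply/mapP; exists m.
have fN : mmap (@polyC k) (kron N s) f != 0.
  by apply: kron_neq0 f0 => m mf; apply: EP; rewrite in_fsetU mf.
have gN : mmap (@polyC k) (kron N s) g != 0.
  by apply: kron_neq0 g0 => m mg; apply: EP; rewrite in_fsetU mg orbT.
have := congr1 (mmap (@polyC k) (kron N s)) fg0.
rewrite mmap0 => /eqP; rewrite rmorphM mulf_eq0 (negPf fN) (negPf gN) //.
Qed.
End PolyDomain.

(** * Linear combinations with finite support *)

Section LinComb.
Variables (k : fieldType) (V : lmodType k) (L : choiceType) (a : L -> V).

Lemma lin_combEw (d : {fset L}) (c : {malg k[L]}) : msupp c `<=` d ->
  lin_comb a c = \sum_(l <- d) c@_l *: a l.
Proof.
move=> le; rewrite /lin_comb (big_fset_incl _ le) // => l _ /mcoeff_outdom ->.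
by rewrite scale0r.
Qed.

Lemma lin_comb_is_linear : linear (lin_comb a).
Proof.
move=> x c1 c2; pose d := msupp c1 `|` msupp c2.
have le1 : msupp c1 `<=` d by apply: fsubsetUl.
have le2 : msupp c2 `<=` d by apply: fsubsetUr.
have le3 : msupp (x *: c1 + c2) `<=` d.
  apply: fsubset_trans (msuppD_le _ _) _.
  by rewrite fsetSU // msuppZ_le.
rewrite (lin_combEw le1) (lin_combEw le2) (lin_combEw le3) scaler_sumr -big_split.
by apply: eq_bigr => l _; rewrite mcoeffD mcoeffZ scalerDl scalerA.
Qed.
HB.instance Definition _ :=
  GRing.isLinear.Build k {malg k[L]} V *:%R (lin_comb a) lin_comb_is_linear.

Lemma lin_combU x l : lin_comb a << x *g l >> = x *: a l.
Proof. by rewrite (lin_combEw msuppU_le) big_seq_fset1 mcoeffUU. Qed.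

End LinComb.

Lemma lin_comb_map (k : fieldType) (V W : lmodType k) (L : choiceType)
    (a : L -> V) (F : {linear V -> W}) (c : {malg k[L]}) :
  F (lin_comb a c) = lin_comb (F \o a) c.
Proof. by rewrite linear_sum; apply: eq_bigr => l _; rewrite linearZ. Qed.

Lemma lin_comb_ord (k : fieldType) (V : lmodType k) n (a : 'I_n -> V)
    (c : {malg k['I_n]}) : lin_comb a c = \sum_i c@_i *: a i.
Proof.
rewrite /lin_comb big_uniq ?fset_uniq // [RHS](bigID (mem (msupp c))) /=.
apply/eqP; rewrite -subr_eq0 opprD addrA subrr add0r oppr_eq0 big1 // => i.
by move/mcoeff_outdom ->; rewrite scale0r.
Qed.

(** * Evaluation of polynomials in a commutative algebra *)

Section Eval.
Variables (k : fieldType) (L : choiceType) (S : comAlgType k) (y : L -> S).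

Definition mon_eval (m : {cmonom L}) : S := \prod_(l <- finsupp m) y l ^+ m l.

Lemma mon_evalEw (d : {fset L}) (m : {cmonom L}) : finsupp m `<=` d ->
  mon_eval m = \prod_(l <- d) y l ^+ m l.
Proof.
move=> le; rewrite /mon_eval (big_fset_incl _ le) // => l _.
by rewrite -cmE_eq0 => /eqP->.
Qed.

Fact mon_eval_mmorphism : mmorphism mon_eval.
Proof.
split=> [m1 m2|]; last by rewrite /mon_eval mdom1 big_seq_fset0.
rewrite {1}/mon_eval mdomD (mon_evalEw (fsubsetUl _ (finsupp m2))).
rewrite (mon_evalEw (fsubsetUr (finsupp m1) _)) -big_split.
by apply: eq_bigr => l _; rewrite cmM exprD.
Qed.
HB.instance Definition _ := isMultiplicative.Build _ _ mon_eval mon_eval_mmorphism.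

Definition pol_eval (f : polyR k L) : S := mmap (in_alg S) mon_eval f.

Fact pol_eval_is_additive : zmod_morphism pol_eval.
Proof. exact: mmap_is_additive. Qed.
HB.instance Definition _ :=
  GRing.isZmodMorphism.Build (polyR k L) S pol_eval pol_eval_is_additive.

Fact pol_eval_is_multiplicative : multiplicative pol_eval.
Proof. exact: mmap_is_multiplicative. Qed.
HB.instance Definition _ :=
  GRing.isMultiplicative.Build (polyR k L) S pol_eval pol_eval_is_multiplicative.

Lemma pol_evalE (f : polyR k L) :
  pol_eval f = \sum_(m <- msupp f) f@_m *: mon_eval m.
Proof. by apply: eq_bigr => m _; rewrite mulr_algl. Qed.

Fact pol_eval_is_scalable : scalable pol_eval.
Proof. by move=> c f; rewrite /pol_eval mmapZ mulr_algl. Qed.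
HB.instance Definition _ :=
  GRing.isScalable.Build k (polyR k L) S *:%R pol_eval pol_eval_is_scalable.

Lemma pol_eval_mon (m : {cmonom L}) : pol_eval << m >> = mon_eval m.
Proof. by rewrite /pol_eval mmapU /= scale1r mul1r. Qed.

Lemma pol_eval_var l : pol_eval (var k l) = y l.
Proof. by rewrite pol_eval_mon /mon_eval mdomU big_seq_fset1 cmUU. Qed.

End Eval.

Lemma pol_eval_comp (k : fieldType) (L : choiceType) (S S' : comAlgType k)
    (y : L -> S) (F : {lrmorphism S -> S'}) (f : polyR k L) :
  F (pol_eval y f) = pol_eval (F \o y) f.
Proof.
rewrite !pol_evalE linear_sum; apply: eq_bigr => m _.
rewrite linearZ /= rmorph_prod; congr (_ *: _).
by apply: eq_bigr => l _; rewrite rmorphXn.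
Qed.

Lemma malgZU (K : choiceType) (R : nzRingType) (c : R) (m : K) :
  c *: << m >> = << c *g m >>.
Proof. by apply/malgP => i; rewrite mcoeffZ !mcoeffU mulrnAr mulr1. Qed.

Lemma malgU_mul (k : fieldType) (L : choiceType) (m1 m2 : {cmonom L}) :
  << mmul m1 m2 >> = << m1 >> * << m2 >> :> polyR k L.
Proof. by rewrite malgM_def fgmulUU mulr1. Qed.

Lemma prod_var_exp (k : fieldType) (L : choiceType) (m : {cmonom L}) :
  \prod_(l <- finsupp m) var k l ^+ m l = << m >>.
Proof.
(* [w l n] is the power [x_l^n] as a monomial; the product of these is then compared with [m]
   exponent by exponent. *)
pose w l n : {cmonom L} := iter n (mmul (ucm l)) mone.
have wE l n : var k l ^+ n = << w l n >>.
  elim: n => [|n IH]; first by rewrite expr0.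
  by rewrite exprS IH [RHS](malgU_mul k (ucm l)).
have w_coef l n i : w l n i = ((l == i) * n)%N.
  elim: n => [|n IH] /=; first by rewrite cm1 muln0.
  by rewrite cmM cmU IH mulnS.
under eq_bigr do rewrite wE.
rewrite -(big_morph _ (@malgU_mul k L) (erefl _)); congr << _ >>.
apply/eqP/cmP => i.
rewrite (big_morph (fun m : {cmonom L} => m i) (id1 := 0%N) (op1 := addn));
  [|by move=> ? ?; rewrite cmM|by rewrite cm1].
case: (mdomP m i) => [im|im].
  rewrite (big_fsetD1 i) //= w_coef eqxx mul1n big1_seq ?addn0 // => l.
  by rewrite in_fsetD1 w_coef => /= /andP[/negPf->].
rewrite big1_seq // => l /= lm; rewrite w_coef.
by case: eqP im lm => // -> /negPf->.
Qed.

(** Only the variables occurring in [f] are constrained, because linear forms are inverted below on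
    a finite set of indices only. *)
Lemma pol_eval_vars (k : fieldType) (L : choiceType) (y : L -> polyR k L)
    (f : polyR k L) :
  (forall m l, m \in msupp f -> l \in finsupp m -> y l = var k l) ->
  pol_eval y f = f.
Proof.
move=> yE; rewrite pol_evalE [RHS]monalgE; apply: eq_big_seq => m mf.
have -> : mon_eval y m = << m >>.
  rewrite -prod_var_exp.
  by apply: eq_big_seq => l lm; rewrite (yE m).
exact: malgZU.
Qed.

(** * Independent linear forms are algebraically independent *)

Lemma sum_delta_scale (k : nzRingType) (V : lmodType k) (I : finType) (j : I)
    (F : I -> V) : \sum_i (j == i)%:R *: F i = F j.
Proof.
rewrite (bigD1 j) //= eqxx scale1r big1 ?addr0 // => i.
by rewrite eq_sym => /negPf->; rewrite scale0r.
Qed.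

(* A left inverse of the coefficient matrix gives a substitution carrying the
   forms [y l] back to the variables. *)
Lemma linear_forms_left_inverse (k : fieldType) (L L' : choiceType)
    (y : L' -> polyR k L) (g : L' -> {malg k[L]}) (W : {fset L'}) :
  (forall l, y l = lin_comb (@var k L) (g l)) ->
  (forall c, lin_comb y c = 0 -> c = 0) ->
  exists theta : L -> polyR k L',
    {in W, forall l, pol_eval theta (y l) = var k l}.
Proof.
move=> yE y_free.
pose ws := in_tuple (enum_fset W).
pose X : {fset L} := [fset x in flatten [seq enum_fset (msupp (g l)) | l <- ws]].
pose xs := in_tuple (enum_fset X).
have ws_inj : injective (tnth ws) by apply/tuple_uniqP/fset_uniq.
have xs_inj : injective (tnth xs) by apply/tuple_uniqP/fset_uniq.
have lin_combX (V : lmodType k) (a : L -> V) i :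
    lin_comb a (g (tnth ws i)) =
    \sum_j (g (tnth ws i))@_(tnth xs j) *: a (tnth xs j).
  rewrite (@lin_combEw _ _ _ _ X) ?(big_tnth _ _ (enum_fset X)) //.
  apply/fsubsetP => x xg; rewrite in_fset /=; apply/flattenP.
  by exists (enum_fset (msupp (g (tnth ws i)))) => //; apply/mapP;
     exists (tnth ws i) => //; apply: mem_tnth.
pose M := \matrix_(i, j) (g (tnth ws i))@_(tnth xs j).
(* A row of the left kernel of [M] is a linear relation between the forms [y l], hence zero. *)
have /row_freeP[B MB] : row_free M.
  rewrite -kermx_eq0; apply/eqP/row_matrixP => r; rewrite row0.
  set u := row r _.
  have uM : u *m M = 0 by rewrite /u -row_mul mulmx_ker row0.
  pose c : {malg k[L']} := \sum_i << u 0 i *g tnth ws i >>.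
  have c0 : c = 0.
    apply: y_free; rewrite /c linear_sum /=.
    under eq_bigr => i _ do rewrite lin_combU yE lin_combX scaler_sumr.
    rewrite exchange_big /= big1 // => j _.
    under eq_bigr do rewrite scalerA.
    rewrite -scaler_suml; move/matrixP/(_ 0 j): uM; rewrite !mxE => uMj.
    rewrite (eq_bigr (fun i => u 0 i * M i j)) => [|i _].
      by rewrite uMj scale0r.
    by rewrite [M i j]mxE.
  apply/rowP => i; rewrite [RHS]mxE.
  move/(congr1 (mcoeff (tnth ws i))): c0; rewrite mcoeff0 /c raddf_sum /=.
  rewrite (bigD1 i) //= mcoeffUU big1 ?addr0 // => j ji.
  by rewrite mcoeffU (inj_eq ws_inj) (negPf ji).
(* The variables occurring in the forms are substituted according to the rows of [B]; all others go
   to 0. *)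
pose theta x : polyR k L' :=
  \sum_j (x == tnth xs j)%:R *: \sum_i B j i *: var k (tnth ws i).
have thetaE j : theta (tnth xs j) = \sum_i B j i *: var k (tnth ws i).
  rewrite /theta.
  rewrite -[RHS](sum_delta_scale _ (fun j => \sum_i B j i *: var k (tnth ws i))).
  by apply: eq_bigr => j' _; rewrite (inj_eq xs_inj).
exists theta => l lW.
have /tnthP[i ->] : l \in ws by [].
rewrite yE lin_comb_map /= lin_combX.
under eq_bigr => j _ do rewrite /= pol_eval_var thetaE scaler_sumr.
rewrite exchange_big.
have coefMB i' : \sum_j (g (tnth ws i))@_(tnth xs j) * B j i' = (i == i')%:R.
  move/matrixP/(_ i i'): MB; rewrite !mxE => <-.
  by apply: eq_bigr => j _; rewrite mxE.
have sumMB i' :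
    \sum_j (g (tnth ws i))@_(tnth xs j) *: (B j i' *: var k (tnth ws i'))
    = (i == i')%:R *: var k (tnth ws i').
  by rewrite -coefMB scaler_suml; apply: eq_bigr => j _; rewrite scalerA.
rewrite -[RHS](sum_delta_scale i (fun i => var k (tnth ws i))).
exact: eq_bigr.
Qed.

(** A substitution [theta] that carries each [y l] back to the variable [l], for the variables of
    [f], turns [f(y) = 0] into [f = 0]. *)
Lemma linear_forms_alg_indep (k : fieldType) (L L' : choiceType)
    (y : L' -> polyR k L) (f : polyR k L') :
  (forall l, exists c, y l = lin_comb (@var k L) c) ->
  (forall c, lin_comb y c = 0 -> c = 0) ->
  pol_eval y f = 0 -> f = 0.
Proof.
move=> /functional_choice[g yE] y_free f0.
pose W : {fset L'} := [fset l in
  flatten [seq enum_fset (finsupp m) | m : {cmonom L'} <- msupp f]].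
have [theta thetaE] := linear_forms_left_inverse W yE y_free.
rewrite -(@pol_eval_vars k L' (pol_eval theta \o y) f) => [|m l mf lm].
  by rewrite -pol_eval_comp f0 rmorph0.
apply: thetaE; rewrite in_fset /=; apply/flattenP.
by exists (enum_fset (finsupp m)) => //; apply/mapP; exists m.
Qed.

(** * Subspaces, ideals and the Fitting radical *)

Section Fitting.
Variables (k : fieldType) (V : lmodType k) (br : V -> V -> V).
Implicit Types S J K : V -> Prop.

Lemma subspaceD J x y : is_subspace J -> J x -> J y -> J (x + y).
Proof. by case=> _ JD Jx Jy; rewrite -[x]scale1r; apply: JD. Qed.

Lemma subspaceZ J c x : is_subspace J -> J x -> J (c *: x).
Proof. by case=> J0 JD Jx; rewrite -[_ *: _]addr0; apply: JD. Qed.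

Lemma subspaceN J x : is_subspace J -> J x -> J (- x).
Proof. by move=> Jsub Jx; rewrite -scaleN1r; apply: subspaceZ. Qed.

Lemma subspace_sum J (I : Type) (r : seq I) (P : pred I) (F : I -> V) :
  is_subspace J -> (forall i, P i -> J (F i)) -> J (\sum_(i <- r | P i) F i).
Proof.
move=> Jsub JF; elim/big_ind: _ => //; first by case: Jsub.
by move=> x y; apply: subspaceD.
Qed.

Lemma subspace_lin_comb J (L : choiceType) (a : L -> V) c :
  is_subspace J -> (forall l, J (a l)) -> J (lin_comb a c).
Proof. by move=> Jsub Ja; apply: subspace_sum => // l _; apply: subspaceZ. Qed.

Lemma subalgebra_ideal S : is_subalgebra br S -> is_ideal br S S.
Proof. by case=> Ssub Sbr; split=> // x y Sx Sy; split; apply: Sbr. Qed.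

Lemma nilpotent_sub_Fit S J :
  is_ideal br S J -> nilpotent br J -> included J (Fit br S).
Proof. by move=> Jid Jnil x Jx K _ /(_ J); apply. Qed.

Lemma Fit_ideal S : is_subalgebra br S -> is_ideal br S (Fit br S).
Proof.
move=> Salg; split.
- by move=> x /(_ S); apply; [apply: subalgebra_ideal | move=> J []].
- split=> [K [_ [] //]|c x y Fx Fy K Kid KJ] //.
  by case: (Kid) => _ [_ KD] _; apply: KD; [apply: Fx|apply: Fy].
- move=> x y Sx Fy; split=> K Kid KJ; case: (Kid) => _ _ /(_ x y Sx (Fy K Kid KJ));
  by case.
Qed.

Lemma abelian_nilpotent J : abelian br J -> nilpotent br J.
Proof.
move=> Jab; exists 1%N => x [|y []] //= _ Jx Js; apply: Jab => //.
by apply: Js; rewrite mem_head.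
Qed.

Lemma pol_actEw (L : choiceType) (a : L -> V) b (f : polyR k L)
    (d : {fset {cmonom L}}) : msupp f `<=` d ->
  pol_act br a b f = \sum_(m <- d) f@_m *: mon_act br a m b.
Proof.
move=> le; rewrite /pol_act (big_fset_incl _ le) // => l _ /mcoeff_outdom ->.
by rewrite scale0r.
Qed.

(** A basis of the zero quotient has an empty index type, so the polynomials are constants and a
    nonzero one acts as an invertible scalar. *)
Lemma torsion_free_trivial_quotient S (L : choiceType) (a : L -> V) :
  included S (Fit br S) -> basis_mod S (Fit br S) a ->
  torsion_free br (Fit br S) a.
Proof.
move=> SF [Sa a_free _] b f Fb f0.
have noL (l : L) : False.
  have /(congr1 (mcoeff l)) /eqP : (<< l >> : {malg k[L]}) = 0.
    by apply: a_free; rewrite lin_combU scale1r; apply: SF.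
  by rewrite mcoeff0 mcoeffUU oner_eq0.
have mon1 (m : {cmonom L}) : m = mone by apply/eqP/cmP => l; case: (noL l).
have le : msupp f `<=` [fset (mone : {cmonom L})].
  by apply/fsubsetP => m _; rewrite in_fset1 [m]mon1 eqxx.
rewrite (pol_actEw _ _ le) big_seq_fset1 /mon_act mdom1 /= => /eqP.
rewrite scaler_eq0 => /orP[f1|/eqP//].
case/negP: f0; apply/eqP/malgP => m; rewrite mcoeff0 (mon1 m); exact/eqP.
Qed.
End Fitting.

(** * Subalgebras of the matrix algebra are U-algebras *)

Section MatrixSubalgebras.
Variables (k : fieldType) (I L : choiceType).
Local Notation R := (polyR k L).
Local Notation M := (Mmat k I L).
Implicit Types (S : M -> Prop) (x y z t : M) (u v : freeT k I L) (r : R).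

Lemma freeT_scale_eq0 r u : r *: u = 0 -> r = 0 \/ u = 0.
Proof.
move=> ru0; apply: NNPP => /not_or_and[r0 u0]; apply: u0.
apply/malgP => i; rewrite mcoeff0; move/(congr1 (mcoeff i)): ru0.
by rewrite mcoeff0 mcoeffZ => /polyR_domain[].
Qed.

Lemma Mbr_abelian x y : x.1 = 0 -> y.1 = 0 -> Mbr x y = 0.
Proof. by move=> x0 y0; rewrite /Mbr x0 y0 !scale0r subrr. Qed.

Lemma Mbr_fst0 x y : x.1 = 0 -> Mbr x y = (0, y.1 *: (x.2 : freeT k I L)).
Proof. by move=> x0; rewrite /Mbr x0 scale0r subr0. Qed.

Lemma foldl_Mbr n r v u :
  foldl (@Mbr k I L) (0, v) (nseq n (r, u)) = (0, r ^+ n *: (v : freeT k I L)).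
Proof.
elim: n v => [|n IH] v /=; first by rewrite expr0 scale1r.
by rewrite (@Mbr_fst0 (0, v) (r, u) erefl) [_.1]/= [_.2]/= IH scalerA -exprSr.
Qed.

Lemma metabelian_Mmat S : metabelian (@Mbr k I L) S.
Proof. by move=> *; apply: Mbr_abelian. Qed.

Lemma polyR_expf_neq0 r n : r <> 0 -> r ^+ n <> 0.
Proof.
move=> r0; elim: n => [|n IH]; first by rewrite expr0; apply/eqP/oner_neq0.
by rewrite exprS => /polyR_domain[].
Qed.

(** The elements of [S] with zero first component form an abelian ideal, which gives one inclusion.
    It also contains every nilpotent ideal: an element [z] with [z.1 <> 0] would multiply [t] by
    nonzero powers of [z.1] under iterated brackets. *)
Lemma Fit_nonabelian S t : is_subalgebra (@Mbr k I L) S ->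
  S t -> t.1 = 0 -> t <> 0 ->
  forall x, Fit (@Mbr k I L) S x <-> S x /\ x.1 = 0.
Proof.
move=> Salg St t1 t0 x; case: (Salg) => Ssub Sbr.
have Kid : is_ideal (@Mbr k I L) S (fun x => S x /\ x.1 = 0).
  split=> [y []//| |y z Sy [Sz z1]].
    split=> [|c y z [Sy y1] [Sz z1]]; first by case: Ssub.
    split; first by case: Ssub => _; apply.
    by rewrite /= y1 z1 scaler0 addr0.
  by split; split=> //; apply: Sbr.
split=> [Fx|]; last first.
  apply: (nilpotent_sub_Fit Kid); apply: abelian_nilpotent.
  by move=> y z [_ y1] [_ z1]; apply: Mbr_abelian.
apply: (Fx _ Kid) => J [JS _ Jbr] [n Jnil] z Jz; split; first exact: JS.
apply: NNPP => z1; case: t0; rewrite (surjective_pairing t) t1.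
(* The product starts at [Mbr t z], which lies in the ideal [J] although [t] itself need not; this
   costs one more power of [z.1]. *)
have /(_ (Mbr t z) (nseq n z)) := Jnil; rewrite size_nseq.
case: (Jbr t z St Jz) => Jtz _ /(_ erefl Jtz) E.
have {}E : foldl (@Mbr k I L) (Mbr t z) (nseq n z) = 0.
  by apply: E => y /nseqP[->].
move: E; rewrite (Mbr_fst0 z t1) [z in nseq _ z](surjective_pairing z) foldl_Mbr.
rewrite scalerA -exprSr => /(congr1 snd) /= /freeT_scale_eq0[].
  by move/(polyR_expf_neq0 z1).
by move->.
Qed.

Lemma mon_act_Mbr (L' : choiceType) (a : L' -> M) m u :
  mon_act (@Mbr k I L) a m (0, u) = (0, mon_eval (fst \o a) m *: u).
Proof.
rewrite /mon_act /mon_eval; elim: (enum_fset _) => [|l s IH] /=.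
  by rewrite big_nil scale1r.
rewrite big_cons IH -scalerA; move: (_ *: u) => w.
elim: (m l) => [|n IHn] /=; first by rewrite expr0 scale1r.
rewrite IHn (@Mbr_fst0 (0, (a l).1 ^+ n *: w) (a l) erefl) [_.2]/= scalerA.
by rewrite -exprS; reflexivity.
Qed.

Lemma Mmat_scale0 (c : k) u : c *: ((0, u) : M) = (0, (c%:A : R) *: u).
Proof.
by apply: (f_equal (fun r : R => (r, freeT_scale c u) : M)); apply: scaler0.
Qed.

Lemma Mmat_add0 u v : ((0, u) : M) + (0, v) = (0, u + v).
Proof. by apply: (f_equal (fun r : R => (r, u + v) : M)); apply: addr0. Qed.

Lemma freeT_scaleAk (c : k) r u : (c%:A : R) *: (r *: u) = (c *: r) *: u.
Proof.
apply: (eq_trans (scalerA _ _ _)).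
exact: (f_equal (fun r => r *: u) (mulr_algl c r)).
Qed.

(** Torsion-freeness thus reduces to [f] not vanishing at the first components of the family. *)
Lemma pol_act_Mbr (L' : choiceType) (a : L' -> M) f u :
  pol_act (@Mbr k I L) a (0, u) f = (0, pol_eval (fst \o a) f *: u).
Proof.
rewrite /pol_act pol_evalE scaler_suml.
elim/big_rec2: _ => [//|m v w _ ->]; rewrite mon_act_Mbr Mmat_scale0 Mmat_add0.
exact: (f_equal (fun w => (0, w + v) : M) (freeT_scaleAk _ _ _)).
Qed.

Lemma U_algebra_sub_M0 S :
  is_subalgebra (@Mbr k I L) S -> included S (@M0 k I L) ->
  U_algebra (@Mbr k I L) S.
Proof.
move=> Salg SM0; case: (Salg) => Ssub Sbr.
(* An abelian [S] is its own Fitting radical and may contain elements with nonzero first component,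
   so it is treated apart. *)
have [Sab|] := classic (abelian (@Mbr k I L) S).
  have SF : included S (Fit (@Mbr k I L) S).
    by apply: nilpotent_sub_Fit; [apply: subalgebra_ideal|apply: abelian_nilpotent].
  split; first exact: metabelian_Mmat.
    by case: (Fit_ideal Salg) => FS _ _ x y /FS Sx /FS Sy; apply: Sab.
  by move=> L' a; apply: torsion_free_trivial_quotient.
move=> nSab.
have [t [St t1 t0]] : exists t, [/\ S t, t.1 = 0 & t <> 0].
  apply: NNPP => not_t; apply: nSab => x y Sx Sy; apply: NNPP => xy0.
  (* Every bracket has first component 0, so any nonzero bracket can serve as [t]. *)
  by apply: not_t; exists (Mbr x y); split=> //; apply: Sbr.
have FitE := Fit_nonabelian Salg St t1 t0.
split; first exact: metabelian_Mmat.
  by move=> x y /FitE[_ x1] /FitE[_ y1]; apply: Mbr_abelian.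
move=> L' a [Sa a_free _] b f /FitE[_ b1] /eqP f0.
rewrite (surjective_pairing b) b1 pol_act_Mbr => /(congr1 snd) /= /freeT_scale_eq0[].
  move/linear_forms_alg_indep => f0'; case: f0; apply: f0' => [l|c c0].
    by apply: SM0; apply: Sa.
  apply: a_free; apply/FitE; split; first exact: subspace_lin_comb.
  by rewrite -[X in X.1]/(lin_comb a c) (lin_comb_map a fst).
by move->.
Qed.
End MatrixSubalgebras.

(** * Monomials as words in the variables *)

Section CMonomWord.
Variable L : choiceType.
Implicit Types (m : {cmonom L}) (l : L).

(** With a monomial spelled as a word, its action is a single [foldr], and commutativity becomes
    invariance under permutation of the word. *)
Definition cmonom_word m : seq L :=
  flatten [seq nseq (m l) l | l <- enum_fset (finsupp m)].

Lemma count_cmonom_word m l : count_mem l (cmonom_word m) = m l.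
Proof.
rewrite count_flatten sumnE !big_map.
under eq_bigr do rewrite count_nseq.
case: (mdomP m l) => [lm|lm].
  rewrite (big_fsetD1 l) //= eqxx mul1n big1_seq ?addn0 // => i.
  by rewrite in_fsetD1 => /= /andP[/negPf->].
rewrite big1_seq // => i /= im.
by case: eqP im => // ->; rewrite (negPf lm).
Qed.

Lemma cmonom_wordM m1 m2 :
  perm_eq (cmonom_word (mmul m1 m2)) (cmonom_word m1 ++ cmonom_word m2).
Proof. by apply/allP => l _ /=; rewrite count_cat !count_cmonom_word cmM. Qed.
End CMonomWord.

(** * Lie brackets and the polynomial action on an abelian ideal *)

Section Bracket.
Variables (k : fieldType) (A : lmodType k) (br : A -> A -> A).
Hypothesis br_lie : is_lie_bracket br.
Implicit Types (x y z w b : A).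

Lemma br_linear_l z : linear (br^~ z).
Proof. by case: br_lie => H _ _ _ c x y; apply: H. Qed.

Lemma br_linear_r z : linear (br z).
Proof. by case: br_lie => _ H _ _ c x y; apply: H. Qed.

Let brl z := HB.pack_for {linear A -> A} (br^~ z)
  (GRing.isLinear.Build k A A *:%R (br^~ z) (br_linear_l z)).
Let brr z := HB.pack_for {linear A -> A} (br z)
  (GRing.isLinear.Build k A A *:%R (br z) (br_linear_r z)).

Lemma brDl x y z : br (x + y) z = br x z + br y z.
Proof. exact: (linearD (brl z)). Qed.

Lemma brDr x y z : br z (x + y) = br z x + br z y.
Proof. exact: (linearD (brr z)). Qed.

Lemma brZl c x z : br (c *: x) z = c *: br x z.
Proof. exact: (linearZ_LR (brl z)). Qed.

Lemma br0l z : br 0 z = 0.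
Proof. exact: (linear0 (brl z)). Qed.

Lemma br_lin_comb_l (L : choiceType) (a : L -> A) c z :
  br (lin_comb a c) z = lin_comb (fun l => br (a l) z) c.
Proof. exact: (lin_comb_map a (brl z)). Qed.

Lemma br_lin_comb_r (L : choiceType) (a : L -> A) c z :
  br z (lin_comb a c) = lin_comb (fun l => br z (a l)) c.
Proof. exact: (lin_comb_map a (brr z)). Qed.

Lemma brC x y : br y x = - br x y.
Proof.
case: br_lie => _ _ alt _; apply/eqP; rewrite -addr_eq0 addrC.
by have := alt (x + y); rewrite brDl !brDr !alt add0r addr0 => /eqP.
Qed.

(** For fixed [x] this has the shape of the second component of [Mbr], with [br z x] and [br w x] as
    the vector parts. *)
Lemma br_jacobi z w x : br (br z w) x = br (br z x) w - br (br w x) z.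
Proof.
case: br_lie => _ _ _ /(_ x z w) /eqP.
rewrite (brC (br z w)) (brC (br w x)) (brC (br x z)) (brC z x).
rewrite -[- br z x]scaleN1r brZl scaleN1r opprK -addrA addrC subr_eq0 => /eqP<-.
by rewrite addrC.
Qed.

Lemma bracket_in_Fit : metabelian br (@setAll k A) ->
  forall x y, Fit br (@setAll k A) (br x y).
Proof.
move=> meta x y.
(* [D] is the derived algebra, as the least subspace containing all brackets. A linear condition on
   [D] need only be checked on brackets, so the metabelian law makes [D] abelian. *)
pose D z := forall P, is_subspace P -> (forall x y, P (br x y)) -> P z.
have Dsub : is_subspace D.
  split=> [P [] //|c z w Dz Dw P Psub Pbr].
  by apply: (subspaceD Psub); [apply: (subspaceZ _ Psub); apply: Dz|apply: Dw].
have Dbr z w : D (br z w) by move=> P _; apply.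
have Did : is_ideal br (@setAll k A) D by split.
apply: (nilpotent_sub_Fit Did) => //; apply: abelian_nilpotent => z w Dz Dw.
apply: (Dw (fun w => br z w = 0)).
  split; first exact: (linear0 (brr z)).
  by move=> c u v zu zv; rewrite br_linear_r zu zv scaler0 addr0.
move=> u v; apply: (Dz (fun z => br z (br u v) = 0)).
  split; first exact: br0l.
  by move=> c z1 z2 E1 E2; rewrite br_linear_l E1 E2 scaler0 addr0.
by move=> z1 z2; apply: meta.
Qed.

Section Action.
Variables (J : A -> Prop) (L : choiceType) (a : L -> A).
Hypotheses (Jsub : is_subspace J) (Jab : abelian br J).
Hypothesis Jbr : forall x y, J (br x y).

(** The remaining Jacobi term is a bracket of two elements of the abelian [J]. This is why the
    variables act by commuting operators. *)
Lemma br_right_comm b x y : J b -> br (br b x) y = br (br b y) x.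
Proof. by move=> Jb; rewrite br_jacobi (Jab (Jbr x y) Jb) subr0. Qed.

Local Notation T := (fun l y => br y (a l)).
Local Notation act := (pol_act br a).

Lemma foldr_br_in s b : J b -> J (foldr T b s).
Proof. by case: s => //= l s _; apply: Jbr. Qed.

Lemma perm_foldr_br s t b : J b -> perm_eq s t -> foldr T b s = foldr T b t.
Proof.
move=> Jb; elim: s t => [|l s IH] t st.
  by move: st; rewrite perm_sym => /perm_nilP->.
have lt : l \in t by rewrite -(perm_mem st) mem_head.
have -> : foldr T b t = foldr T b (l :: rem l t).
  elim: t lt {st} => //= x t IHt; rewrite inE.
  have [->//|ne /= lt] := eqVneq x l; rewrite IHt //=.
  by apply: br_right_comm; apply: foldr_br_in.
by congr (br _ _); apply: IH; rewrite -(perm_cons l) (perm_trans st) // perm_to_rem.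
Qed.

Lemma mon_act_word m b : mon_act br a m b = foldr T b (cmonom_word m).
Proof.
rewrite /mon_act /cmonom_word; elim: (enum_fset _) => //= l s ->.
by rewrite foldr_cat; elim: (m l) => //= n ->.
Qed.

Lemma mon_act_in m b : J b -> J (mon_act br a m b).
Proof. by rewrite mon_act_word; apply: foldr_br_in. Qed.

Lemma mon_actM m1 m2 b : J b ->
  mon_act br a (mmul m1 m2) b = mon_act br a m2 (mon_act br a m1 b).
Proof.
move=> Jb; rewrite !mon_act_word -foldr_cat; apply: perm_foldr_br => //.
by rewrite mulmC cmonom_wordM.
Qed.

Lemma mon_act_is_linear m : linear (mon_act br a m).
Proof.
move=> c x y; rewrite !mon_act_word; elim: (cmonom_word m) => //= l s ->.
exact: br_linear_l.
Qed.

Lemma pol_act_is_linear f : linear (act^~ f).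
Proof.
move=> c x y; rewrite /pol_act scaler_sumr -big_split; apply: eq_bigr => m _ /=.
by rewrite mon_act_is_linear scalerDr !scalerA mulrC.
Qed.

(** [act b] is by definition the [lin_comb] of the family of all [mon_act br a m b]. *)
Lemma pol_act_linear_r b : linear (act b).
Proof. exact: (@lin_comb_is_linear _ _ _ (fun m => mon_act br a m b)). Qed.

Lemma pol_actU c m b : act b << c *g m >> = c *: mon_act br a m b.
Proof. exact: (@lin_combU _ _ _ (fun m => mon_act br a m b)). Qed.

Lemma pol_actM f g b : J b -> act b (f * g) = act (act b f) g.
Proof.
move=> Jb; pose h m := mon_act br a m b.
pose mon_lin m := HB.pack_for {linear A -> A} (mon_act br a m)
  (GRing.isLinear.Build k A A *:%R (mon_act br a m) (mon_act_is_linear m)).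
rewrite malgME -[LHS]/(lin_comb h _) linear_sum /=.
have -> : act (act b f) g = \sum_(m2 <- msupp g) \sum_(m1 <- msupp f)
    (f@_m1 * g@_m2) *: h (mmul m1 m2).
  apply: eq_bigr => m2 _.
  rewrite -[mon_act _ _ _ _]/(mon_lin m2 (act b f)) linear_sum scaler_sumr.
  apply: eq_bigr => m1 _; rewrite linearZ scalerA mulrC; congr (_ *: _).
  by rewrite /h mon_actM.
rewrite exchange_big; apply: eq_bigr => m1 _.
rewrite linear_sum; apply: eq_bigr => m2 _.
exact: lin_combU.
Qed.

Lemma pol_act_in f b : J b -> J (act b f).
Proof.
move=> Jb; apply: subspace_sum => // m _.
by apply: subspaceZ => //; apply: mon_act_in.
Qed.

Lemma pol_act_var l b : act b (var k l) = br b (a l).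
Proof.
rewrite pol_actU scale1r mon_act_word.
have /perm_small_eq -> // : perm_eq (cmonom_word (ucm l)) [:: l].
by apply/allP => i _ /=; rewrite count_cmonom_word cmU addn0.
Qed.

Lemma pol_act_lin_comb c b : act b (lin_comb (@var k L) c) = br b (lin_comb a c).
Proof.
rewrite br_lin_comb_r /lin_comb.
elim/big_rec2: _ => [|l x f _ <-].
  exact: (@linear0 _ _ _ _ (@lin_comb _ _ _ (fun m => mon_act br a m b))).
by rewrite pol_act_linear_r pol_act_var.
Qed.

End Action.
End Bracket.

(** * Maximal independent families and common denominators *)

(* [D] and [Z] let one lemma serve both for a basis of A/J ([R] = k, [D] = A,
   [Z] = J) and for the module J over the polynomial ring ([D] = J, [Z] = 0). *)
Section MaximalIndependent.
Variables (R : comNzRingType) (V : zmodType) (act : V -> R -> V).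
Variables (D Z : V -> Prop).
Hypothesis R_domain : forall r s : R, r * s = 0 -> r = 0 \/ s = 0.
Hypothesis actDr : forall x r s, act x (r + s) = act x r + act x s.
Hypothesis actDl : forall x y r, act (x + y) r = act x r + act y r.
Hypothesis actM : forall x r s, D x -> act x (r * s) = act (act x r) s.
Hypothesis Z0 : Z 0.
Hypothesis Zact : forall x r, Z x -> Z (act x r).

Lemma act_r0 x : act x 0 = 0.
Proof. by apply: (@addrI _ (act x 0)); rewrite -actDr !addr0. Qed.

Lemma act_rN x r : act x (- r) = - act x r.
Proof. by apply/eqP; rewrite -addr_eq0 -actDr addNr act_r0. Qed.

Lemma act_0l r : act 0 r = 0.
Proof. by apply: (@addrI _ (act 0 r)); rewrite -actDl !addr0. Qed.

Lemma act_Nl x r : act (- x) r = - act x r.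
Proof. by apply/eqP; rewrite -addr_eq0 -actDl addNr act_0l. Qed.

Lemma act_suml n (v : 'I_n -> V) r :
  act (\sum_i v i) r = \sum_i act (v i) r.
Proof. by apply: (big_morph (act^~ r)) => [x y|]; rewrite ?actDl ?act_0l. Qed.

Lemma span_mul n (v : 'I_n -> V) (r : 'I_n -> R) x d e :
  (forall i, D (v i)) -> D x ->
  Z (act x d - \sum_i act (v i) (r i)) ->
  Z (act x (d * e) - \sum_i act (v i) (r i * e)).
Proof.
move=> Dv Dx /(Zact e); rewrite actDl act_Nl act_suml actM //.
by under [in X in _ -> X]eq_bigr do rewrite actM //.
Qed.

(** Induction on [gs]. If a nonzero multiple of the new [x] lies in the span of [v] modulo [Z], its
    multiplier is absorbed into [d], which stays nonzero in a domain; otherwise [x] joins the family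
    and [d] is kept. *)
Lemma maximal_independent (gs : seq V) : (forall g, g \in gs -> D g) ->
  exists n (v : 'I_n -> V) (d : R),
  [/\ d <> 0, forall i, D (v i),
      forall r : 'I_n -> R, Z (\sum_i act (v i) (r i)) -> forall i, r i = 0 &
      forall g, g \in gs -> exists r : 'I_n -> R,
        Z (act g d - \sum_i act (v i) (r i))].
Proof.
elim: gs => [|x gs IH] Dgs.
  exists 0%N, (fun => 0), 1; split; [|by case|by move=> r _ []|by []].
  exact/eqP/oner_neq0.
have [g gs_g|n [v [d [d0 Dv v_free v_span]]]] := IH.
  by apply: Dgs; rewrite inE gs_g orbT.
have Dx : D x by apply: Dgs; rewrite mem_head.
have [[r0 [r [r0N0 Zr]]]|x_free] := classic (exists r0 (r : 'I_n -> R),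
    r0 <> 0 /\ Z (act x r0 - \sum_i act (v i) (r i))).
  exists n, v, (d * r0); split=> // [/R_domain[]//|g].
  rewrite inE => /orP[/eqP->|gs_g].
    by exists (fun i => r i * d); rewrite mulrC; apply: span_mul.
  have [s Zs] := v_span g gs_g.
  exists (fun i => s i * r0); apply: span_mul => //.
  by apply: Dgs; rewrite inE gs_g orbT.
(* [v'] is [v] with [x] inserted at index 0. *)
pose v' i := oapp v x (unlift ord0 i).
have sumv' (r : 'I_n.+1 -> R) : \sum_i act (v' i) (r i) =
    act x (r ord0) + \sum_i act (v i) (r (lift ord0 i)).
  rewrite big_ord_recl /v' unlift_none; congr (_ + _).
  by apply: eq_bigr => i _; rewrite liftK.
exists n.+1, v', d; split=> // [i|r|g].
- by rewrite /v'; case: unliftP => [j|] _ /=.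
- rewrite sumv' => Zr.
  have r0 : r ord0 = 0.
    apply: NNPP => r0; apply: x_free; exists (r ord0), (fun i => - r (lift ord0 i)).
    split=> //; rewrite -sumrN.
    by under eq_bigr do rewrite act_rN opprK.
  move: Zr; rewrite r0 act_r0 add0r => /v_free rl i.
  by case: (unliftP ord0 i) => [j|] ->.
rewrite inE => /orP[/eqP->|gs_g].
  exists (fun i => if i == ord0 then d else 0).
  rewrite sumv' eqxx big1 ?addr0 ?subrr // => i _.
  by rewrite eq_sym (negPf (neq_lift _ _)) act_r0.
have [s Zs] := v_span g gs_g.
exists (fun i => oapp s 0 (unlift ord0 i)).
rewrite sumv' unlift_none act_r0 add0r.
by under eq_bigr do rewrite liftK.
Qed.
End MaximalIndependent.

(** * A finite basis modulo the Fitting radical, and coordinates on the radical *)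

Section Embedding.
Variables (k : fieldType) (A : lmodType k) (br : A -> A -> A).
Hypothesis br_lie : is_lie_bracket br.
Hypothesis A_fg : fin_generated br (@setAll k A).
Hypothesis A_U : U_algebra br (@setAll k A).
Local Notation J := (Fit br (@setAll k A)).
Implicit Types (x y z b : A).

Lemma Fit_bracket x y : J (br x y).
Proof. by case: A_U => meta _ _; apply: bracket_in_Fit. Qed.

Lemma Fit_subspace : is_subspace J.
Proof. by case: (@Fit_ideal _ _ br (@setAll k A)). Qed.
Local Notation Jsub := Fit_subspace.

Lemma Fit_abelian : abelian br J.
Proof. by case: A_U. Qed.

(** A maximal family of generators independent modulo [J] is a basis: the elements congruent to a
    combination of it form a subalgebra, since all brackets lie in [J]. *)
Lemma finite_basis_mod_Fit :
  exists n (a : 'I_n -> A), basis_mod (@setAll k A) J a.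
Proof.
case: A_fg => s [_ s_gen].
have [| | | | | | |n [a [d [d0 _ a_free a_span]]]] := @maximal_independent k A
  (fun x c => c *: x) (@setAll k A) J _ _ _ _ _ _ s.
- by move=> r t /eqP; rewrite mulf_eq0 => /orP[]/eqP; [left|right].
- by move=> x r t; apply: scalerDl.
- by move=> x y r; apply: scalerDr.
- by move=> x r t _; rewrite scalerA mulrC.
- by case: Jsub.
- by move=> x r; apply: subspaceZ Jsub.
- by [].
exists n, a; split=> // [c|x _].
  by rewrite lin_comb_ord => /a_free c0; apply/malgP => i; rewrite mcoeff0.
apply: (s_gen (fun x => exists c : {malg k['I_n]}, J (x - lin_comb a c))) => //.
  split=> [|y z _ _]; last first.
    by exists 0; rewrite linear0 subr0; apply: Fit_bracket.
  split=> [|e y z [cy Jy] [cz Jz]].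
    by exists 0; rewrite linear0 subr0; case: Jsub.
  exists (e *: cy + cz); rewrite linearP opprD addrACA -scalerBr.
  by apply: (proj2 Jsub).
(* Over the field [k] the common denominator [d] can be inverted. *)
move=> y /a_span[r Jy]; exists (\sum_i << d^-1 * r i *g i >>).
have -> : lin_comb a (\sum_i << d^-1 * r i *g i >>) = d^-1 *: \sum_i r i *: a i.
  rewrite linear_sum scaler_sumr; apply: eq_bigr => i _; rewrite scalerA.
  exact: lin_combU.
rewrite -[y](scalerK (introN eqP d0)) -scalerBr.
exact: subspaceZ Jsub Jy.
Qed.

Section Coordinates.
Variables (n : nat) (a : 'I_n -> A).
Hypothesis a_basis : basis_mod (@setAll k A) J a.
Local Notation R := (polyR k 'I_n).
Local Notation act := (pol_act br a).
Local Notation form := (lin_comb (@var k 'I_n)).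

Lemma lin_part_uniq x (c c' : {malg k['I_n]}) :
  J (x - lin_comb a c) -> J (x - lin_comb a c') -> c = c'.
Proof.
case: a_basis => _ a_free _ Jc Jc'; apply/eqP; rewrite -subr_eq0; apply/eqP.
apply: a_free; rewrite linearB /=.
have := subspaceD Jsub Jc' (subspaceN Jsub Jc).
by rewrite opprB addrC subrKA.
Qed.

Lemma lin_part_exists : exists lp : A -> {malg k['I_n]},
  forall x, J (x - lin_comb a (lp x)).
Proof.
case: a_basis => _ _ a_span.
have /functional_choice[lp lpP] x : exists c, J (x - lin_comb a c) by apply: a_span.
by exists lp.
Qed.

(** The component of [y] in [J] commutes with [b], so only the linear form of [y] acts. *)
Lemma br_form b y (c : {malg k['I_n]}) :
  J b -> J (y - lin_comb a c) -> br b y = act b (form c).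
Proof.
move=> Jb Jy; rewrite pol_act_lin_comb // -[y in LHS](subrK (lin_comb a c)).
by rewrite brDr // (Fit_abelian Jb Jy) add0r.
Qed.

Lemma Fit_coordinates : exists m (rho : A -> 'I_m -> R),
  [/\ forall c x y i, J x -> J y -> rho (c *: x + y) i = c *: rho x i + rho y i,
      forall x f i, J x -> rho (act x f) i = f * rho x i &
      forall x, J x -> (forall i, rho x i = 0) -> x = 0].
Proof.
have Jab := Fit_abelian; have Jbr := Fit_bracket.
have actDr x f g : act x (f + g) = act x f + act x g.
  by have := pol_act_linear_r br a x 1 f g; rewrite !scale1r.
have actDl x y f : act (x + y) f = act x f + act y f.
  by have := pol_act_is_linear br_lie a f 1 x y; rewrite !scale1r.
have actM x f g : J x -> act x (f * g) = act (act x f) g by apply: pol_actM.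
case: A_fg => s [_ s_gen]; have [lp lpP] := lin_part_exists.
pose gs := [seq br (a p.1) (a p.2) | p : 'I_n * 'I_n] ++
  [seq x - lin_comb a (lp x) | x <- s].
have [| | | | | | |m [v [d [d0 Jv v_free v_span]]]] := @maximal_independent R A
  act J (fun x => x = 0) _ _ _ _ _ _ gs.
- exact: polyR_domain.
- exact: actDr.
- exact: actDl.
- exact: actM.
- by [].
- by move=> x f ->; apply: (act_0l actDl).
- by move=> g; rewrite mem_cat => /orP[] /mapP[x _ ->].
(* [P] singles out the elements that [d] brings into the span of [v]; the aim is that it contains
   [J]. *)
pose P b := exists r : 'I_m -> R, act b d = \sum_i act (v i) (r i).
have P_gs g : g \in gs -> P g.
  by move=> /v_span[r /eqP]; rewrite subr_eq0 => /eqP; exists r.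
have Psub : is_subspace P.
  split=> [|c x y [r xE] [t yE]].
    exists (fun=> 0); rewrite (act_0l actDl) big1 // => i _.
    exact: (act_r0 actDr).
  exists (fun i => c *: r i + t i); rewrite pol_act_is_linear // xE yE.
  rewrite scaler_sumr -big_split; apply: eq_bigr => i _.
  by rewrite pol_act_linear_r.
have Pact b f : J b -> P b -> P (act b f).
  move=> Jb [r bE]; exists (fun i => r i * f).
  rewrite -actM // mulrC actM // bE.
  rewrite (act_suml actDl); apply: eq_bigr => i _.
  by rewrite actM.
have Pbrr b c : J b -> P b -> P (br b (lin_comb a c)).
  by move=> Jb Pb; rewrite -pol_act_lin_comb //; apply: Pact.
(* Of the four terms of the expanded bracket, one vanishes in [J], two are images of [x] and [y]
   under linear forms, and the last combines the brackets of basis elements put in [gs]. *)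
have Pbr x y c e : J x -> P x -> J y -> P y ->
    P (br (x + lin_comb a c) (y + lin_comb a e)).
  move=> Jx Px Jy Py; rewrite (brDl br_lie) !(brDr br_lie) (Jab x y) // add0r.
  apply: (subspaceD Psub); first exact: Pbrr.
  apply: (subspaceD Psub).
    by rewrite (brC br_lie); apply: (subspaceN Psub); apply: Pbrr.
  rewrite (br_lin_comb_l br_lie); apply: (subspace_lin_comb _ Psub) => i.
  rewrite (br_lin_comb_r br_lie); apply: (subspace_lin_comb _ Psub) => j.
  apply: P_gs; rewrite mem_cat; apply/orP; left.
  by apply/mapP; exists (i, j) => //; rewrite mem_enum.
have PJ b : J b -> P b.
  move=> Jb.
  (* The elements whose component in [J] satisfies [P] form a subalgebra containing the generators;
     for [b] in [J] the linear part is 0. *)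
  have [] : exists c, J (b - lin_comb a c) /\ P (b - lin_comb a c).
    apply: (s_gen (fun z => exists c,
      J (z - lin_comb a c) /\ P (z - lin_comb a c))) => //.
    - split=> [|x y [c [Jx Px]] [e [Jy Py]]].
        split=> [|c x y [cx [Jx Px]] [cy [Jy Py]]].
          exists 0; rewrite linear0 subr0.
          by split; [case: Jsub|case: Psub].
        exists (c *: cx + cy); rewrite linearP opprD addrACA -scalerBr.
        by split; [apply: (proj2 Jsub)|apply: (proj2 Psub)].
      exists 0; rewrite linear0 subr0; split; first exact: Jbr.
      rewrite -[x](subrK (lin_comb a c)) -[y](subrK (lin_comb a e)).
      exact: Pbr.
    move=> x sx; exists (lp x); split; first exact: lpP.
    by apply: P_gs; rewrite mem_cat; apply/orP; right; apply/mapP; exists x.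
  move=> c [Jc]; suff -> : c = 0 by rewrite linear0 subr0.
  by apply: (lin_part_uniq Jc); rewrite linear0 subr0.
have /functional_choice[rho rhoP] b : exists r : 'I_m -> R,
    J b -> act b d = \sum_i act (v i) (r i).
  have [/PJ[r bE]|nJ] := classic (J b); first by exists r.
  (* Outside [J] the value of [rho] is arbitrary. *)
  by exists (fun=> 0).
have rho_uniq b (r : 'I_m -> R) : J b ->
    act b d = \sum_i act (v i) (r i) -> forall i, rho b i = r i.
  move=> Jb bE i; apply/eqP; rewrite -subr_eq0; apply/eqP.
  apply: (v_free (fun i => rho b i - r i)).
  under eq_bigr do rewrite actDr (act_rN actDr).
  by rewrite big_split /= sumrN -rhoP // -bE subrr.
(* Linearity over [k] and over [R] follows from uniqueness of coordinates, and injectivity from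
   torsion-freeness applied to [d]. *)
exists m, rho; split=> [c x y i Jx Jy|x f i Jx|x Jx rho0].
- apply: (rho_uniq _ (fun i => c *: rho x i + rho y i)).
    exact: (proj2 Jsub).
  rewrite pol_act_is_linear // rhoP // rhoP // scaler_sumr -big_split.
  by apply: eq_bigr => j _; rewrite pol_act_linear_r.
- apply: (rho_uniq _ (fun i => f * rho x i)); first exact: (pol_act_in a Jsub Jbr).
  rewrite -actM // mulrC actM // rhoP //.
  rewrite (act_suml actDl); apply: eq_bigr => j _.
  by rewrite mulrC actM.
case: A_U => _ _ /(_ _ a a_basis); apply; [exact: Jx|apply/eqP/d0|].
by rewrite rhoP // big1 // => i _; rewrite rho0; apply: (act_r0 actDr).
Qed.
End Coordinates.
End Embedding.

(** * Construction of the embedding *)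

Definition malg_of_fun (G : zmodType) m (r : 'I_m -> G) : {malg G['I_m]} :=
  \sum_i << r i *g i >>.

Lemma mcoeff_malg_of_fun (G : zmodType) m (r : 'I_m -> G) i :
  (malg_of_fun r)@_i = r i.
Proof.
rewrite raddf_sum (bigD1 i) //= mcoeffUU big1 ?addr0 // => j ji.
by rewrite mcoeffU (negPf ji).
Qed.

Lemma lin_comb_var_eq0 (k : fieldType) (L : choiceType) (c : {malg k[L]}) :
  lin_comb (@var k L) c = 0 -> c = 0.
Proof.
move=> c0; apply/malgP => l; rewrite mcoeff0.
have ucm_inj i j : (ucm i == ucm j :> {cmonom L}) = (i == j).
  apply/eqP/eqP => [E|-> //]; apply/eqP; move: (cmUU i).
  by rewrite E cmU eq_sym; case: eqP.
have coefE i : (c@_i *: var k i)@_(ucm l) = c@_i *+ (i == l).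
  rewrite -(ucm_inj i l) -mcoeffU; congr mcoeff; exact: malgZU.
have := congr1 (mcoeff (ucm l)) c0; rewrite mcoeff0 raddf_sum.
rewrite (eq_bigr _ (fun i _ => coefE i)).
case: (msuppP c l) => // lc.
rewrite (big_fsetD1 l) //= eqxx big1_seq ?addr0 // => i.
by rewrite in_fsetD1 => /= /andP[/negPf->].
Qed.

Section Embed.
Variables (k : fieldType) (A : lmodType k) (br : A -> A -> A).
Hypothesis br_lie : is_lie_bracket br.
Hypothesis A_U : U_algebra br (@setAll k A).
Local Notation J := (Fit br (@setAll k A)).
Local Notation Jsub := (Fit_subspace br).
Variables (n : nat) (a : 'I_n -> A).
Hypothesis a_basis : basis_mod (@setAll k A) J a.
Local Notation R := (polyR k 'I_n).
Local Notation act := (pol_act br a).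
Variables (m : nat) (rho : A -> 'I_m -> R).
Hypothesis rho_linear : forall c x y i, J x -> J y ->
  rho (c *: x + y) i = c *: rho x i + rho y i.
Hypothesis rho_act : forall x f i, J x -> rho (act x f) i = f * rho x i.
Hypothesis rho_inj : forall x, J x -> (forall i, rho x i = 0) -> x = 0.
Local Notation M := (Mmat k 'I_m 'I_n).

Lemma rho0 i : rho 0 i = 0.
Proof.
have J0 : J 0 by case: Jsub.
have := rho_linear 1 i J0 J0; rewrite !scale1r addr0 => /eqP.
by rewrite -subr_eq0 opprD addrA subrr sub0r oppr_eq0 => /eqP.
Qed.

Definition coord_vec x : freeTk k 'I_m 'I_n := malg_of_fun (rho x).

Lemma coord_vec_linear c x y : J x -> J y ->
  coord_vec (c *: x + y) = c *: coord_vec x + coord_vec y.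
Proof.
move=> Jx Jy; apply/malgP => i.
rewrite (mcoeff_malg_of_fun _ i) rho_linear //.
apply: esym; apply: (eq_trans (mcoeffD i _ _)).
rewrite (mcoeff_malg_of_fun (rho y)); congr (_ + _).
apply: (eq_trans (mcoeffZ (c%:A : R) (malg_of_fun (rho x)) i)).
by rewrite mcoeff_malg_of_fun; apply: mulr_algl.
Qed.

Lemma coord_vec_eq0 x : J x -> coord_vec x = 0 -> x = 0.
Proof.
move=> Jx x0; apply: rho_inj => // i.
by rewrite -(mcoeff_malg_of_fun (rho x)) -[malg_of_fun _]/(coord_vec x) x0 mcoeff0.
Qed.

Lemma injective_of_linear_ker (phi : A -> M) :
  (forall c x y, phi (c *: x + y) = c *: phi x + phi y) ->
  (forall x, phi x = 0 -> x = 0) -> injective phi.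
Proof.
move=> phiP phi0 x y xy; apply/eqP; rewrite -subr_eq0; apply/eqP/phi0.
by rewrite addrC -scaleN1r phiP xy scaleN1r addNr.
Qed.

(** An empty basis means that [J] is all of [A], so [A] is abelian and its coordinate vectors alone,
    with first component 0, give the embedding. *)
Lemma abelian_embedding : n = 0%N -> exists phi : A -> M,
  [/\ lie_hom br (@Mbr k 'I_m 'I_n) phi, injective phi & forall x, M0 (phi x)].
Proof.
move=> n0.
have allJ x : J x.
  case: a_basis => _ _ /(_ x I)[c].
  suff -> : lin_comb a c = 0 by rewrite subr0.
  rewrite lin_comb_ord big1 // => i _.
  by have := ltn_ord i; rewrite [X in (_ < X)%N]n0.
pose phi x : M := (0, coord_vec x).
have phiP c x y : phi (c *: x + y) = c *: phi x + phi y.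
  rewrite /phi coord_vec_linear //.
  rewrite -[RHS]/((c *: 0 + 0, c *: coord_vec x + coord_vec y) : M).
  by rewrite scaler0 addr0.
exists phi; split.
- split=> // x y; rewrite Mbr_abelian // /phi (Fit_abelian A_U (allJ x) (allJ y)).
  congr (_, _); apply/malgP => i.
  by rewrite (mcoeff_malg_of_fun _ i) rho0 mcoeff0.
- by apply: injective_of_linear_ker => // x /(congr1 snd); apply: coord_vec_eq0.
by move=> x; exists 0; rewrite msupp0 big_seq_fset0.
Qed.

(** The coordinates are controlled only on [J]; bracketing with [a o] first brings every element of
    [A] into [J]. *)
Lemma nonabelian_embedding (o : 'I_n) : exists phi : A -> M,
  [/\ lie_hom br (@Mbr k 'I_m 'I_n) phi, injective phi & forall x, M0 (phi x)].
Proof.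
have [lp lpP] := lin_part_exists a_basis.
have Jbr := Fit_bracket br_lie A_U.
have lp_uniq := lin_part_uniq a_basis.
have lp_linear c x y : lp (c *: x + y) = c *: lp x + lp y.
  apply: (lp_uniq _ _ _ (lpP _)); rewrite linearP opprD addrACA -scalerBr.
  exact: (proj2 Jsub).
have lp_br x y : lp (br x y) = 0.
  by apply: (lp_uniq _ _ _ (lpP _)); rewrite linear0 subr0.
pose form x : R := lin_comb (@var k 'I_n) (lp x).
pose phi x : M := (form x, coord_vec (br x (a o))).
have rho_br b y i : J b -> rho (br b y) i = form y * rho b i.
  by move=> Jb; rewrite (br_form br_lie A_U Jb (lpP y)); apply: rho_act.
have rhoE x y i : rho (br (br x y) (a o)) i =
    form y * rho (br x (a o)) i - form x * rho (br y (a o)) i.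
  rewrite (br_jacobi br_lie) addrC -scaleN1r.
  rewrite (rho_linear _ _ (Jbr _ _) (Jbr _ _)).
  rewrite (rho_br _ y i (Jbr _ _)) (rho_br _ x i (Jbr _ _)).
  by rewrite [X in X + _]scaleN1r [LHS]addrC; reflexivity.
have phiP c x y : phi (c *: x + y) = c *: phi x + phi y.
  rewrite /phi /form lp_linear linearP br_linear_l //.
  by rewrite coord_vec_linear.
exists phi; split; last by move=> x; exists (lp x).
  split=> // x y.
  rewrite /phi /form lp_br linear0 /Mbr; congr (_, _); apply/malgP => i.
  rewrite (mcoeff_malg_of_fun _ i) rhoE.
  apply: esym; apply: (eq_trans (mcoeffB i _ _)); congr (_ - _).
    apply: (eq_trans (mcoeffZ _ _ i)); congr (_ * _).
    exact: mcoeff_malg_of_fun.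
  apply: (eq_trans (mcoeffZ _ _ i)); congr (_ * _).
  exact: mcoeff_malg_of_fun.
(* A vanishing first component puts [x] in [J], where bracketing with [a o] is multiplication by the
   nonzero polynomial [var k o]. *)
apply: injective_of_linear_ker => // x phi0.
have /lin_comb_var_eq0 lp0 : form x = 0 := congr1 fst phi0.
have Jx : J x by have := lpP x; rewrite lp0 linear0 subr0.
have xo0 : br x (a o) = 0 by apply: coord_vec_eq0 => //; exact: (congr1 snd phi0).
case: A_U => _ _ /(_ _ a a_basis x (var k o) Jx); apply.
  by rewrite monalgU_eq0 oner_neq0.
by rewrite pol_act_var.
Qed.
End Embed.

Theorem theorem3p2p1 (k : fieldType) :
  (* every finitely generated metabelian Lie U-algebra embeds in some M^0 *)
  (forall (A : lmodType k) (brA : A -> A -> A),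
     is_lie_bracket brA -> fin_generated brA (@setAll k A) ->
     U_algebra brA (@setAll k A) ->
     exists (I L : choiceType) (phi : A -> Mmat k I L),
       [/\ lie_hom brA (@Mbr k I L) phi, injective phi &
           forall x, M0 (phi x)]) /\
  (* every subalgebra of M^0_{I,L} is a metabelian Lie U-algebra *)
  (forall (I L : choiceType) (S : Mmat k I L -> Prop),
     is_subalgebra (@Mbr k I L) S -> included S (@M0 k I L) ->
     U_algebra (@Mbr k I L) S).
Proof.
split=> [A brA br_lie A_fg A_U|I L S]; last exact: U_algebra_sub_M0.
have [n [a a_basis]] := finite_basis_mod_Fit br_lie A_fg A_U.
have [m [rho [rho_linear rho_act rho_inj]]] :=
  Fit_coordinates br_lie A_fg A_U a_basis.
exists 'I_m, 'I_n.
have [n0|n0] := posnP n; last first.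
  exact: (nonabelian_embedding br_lie A_U a_basis rho_linear rho_act rho_inj
    (Ordinal n0)).
exact: (abelian_embedding A_U a_basis rho_linear rho_inj n0).
Qed.
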